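(* For every integer $Q\ge \exp\{e^{22}\}$ and every subinterval $I=(\alpha,\beta]\subseteq(0,1]$ (with $\alpha<\beta$, $|I|=\beta-\alpha$), we have $$C_0(Q,I)<\frac{12}{\pi^2}+\frac{2.01}{\log Q}+\frac{7.06}{|I|\log Q}.$$ If in addition $\beta-\alpha\ge 4/\log Q$, then $$C_0(Q,I)<3.$$
   Context: For an integer $Q\ge 2$, let $F_Q=\{a/q: 1\le a\le q\le Q,\ \gcd(a,q)=1\}$ be the $Q$-th Farey sequence, $N=|F_Q|$, and write $F_Q=\{\gamma_1<\gamma_2<\dots<\gamma_N\}$, extended periodically by $\gamma_{j+N}=\gamma_j+1$. For a subinterval $I$ of $(0,1]$ of length $|I|$, let $F_I(Q)=\{a/q\in I: 1\le a\le q\le Q,\ \gcd(a,q)=1\}$ and $$S_0(Q,I)=\sum_{\gamma_j\in F_I(Q)}(\gamma_{j+1}-\gamma_j)^2,\qquad C_0(Q,I)=\frac{S_0(Q,I)\,Q^2}{|I|\log Q},$$ where the sum is over $1\le j\le N$ with $\gamma_j\in I$ (and $\gamma_{j+1}$ is the successor of $\gamma_j$ in the full, periodically extended, Farey sequence). *)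

(* Defs.v *)
From HB Require Import structures.
From mathcomp Require Import all_boot all_order all_algebra.
From mathcomp Require Import all_classical all_reals all_analysis.
Set Implicit Arguments.
Unset Strict Implicit.
Unset Printing Implicit Defensive.
Import Order.TTheory GRing.Theory Num.Theory.
Local Open Scope ring_scope.

Definition farey (Q : nat) : seq rat :=
  sort <=%R (undup [seq a%:R / q%:R | q <- iota 1 Q,
                                      a <- [seq a <- iota 1 q | coprime a q]]).

(* The periodic extension over all of Z, with gamma Q 1, ..., gamma Q N
   (N = size (farey Q)) the elements of farey Q in increasing order; the shift
   by 1 converts to the 0-based indices of nth. *)
Definition gamma (Q : nat) (j : int) : rat :=
  let N := (size (farey Q))%:Z in
  nth 0 (farey Q) `|((j - 1) %% N)%Z|%N + ((j - 1) %/ N)%Z%:Q.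

Definition S0 (R : realType) (Q : nat) (I : interval R) : R :=
  \sum_(1 <= j < (size (farey Q)).+1 | ratr (gamma Q j%:Z) \in I)
    ratr (gamma Q (j%:Z + 1) - gamma Q j%:Z) ^+ 2.

Definition C0 (R : realType) (Q : nat) (alpha beta : R) : R :=
  S0 Q `]alpha, beta] * Q%:R ^+ 2 / ((beta - alpha) * ln Q%:R).

(* Main.v *)
Require Import Defs.
From HB Require Import structures.
From mathcomp Require Import all_boot all_order all_algebra.
From mathcomp Require Import all_classical all_reals all_analysis.
From mathcomp Require Import ring lra zify.
Import Order.TTheory GRing.Theory Num.Theory.
Import numFieldNormedType.Exports.
Local Open Scope ring_scope.

(** Write q and q' for the denominators of two consecutive fractions. They
    differ by 1/(q q'), and Q < q + q' since otherwise their mediant would lie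
    between them. Expanding Q^2 <= (q + q')^2 gives

      Q^2 (1/(q q'))^2  <=  1/q^2 + 1/q'^2 + 2/(q q').

    Summed over the fractions of I, the last term telescopes to about 2|I|, and
    each of the first two yields G, the sum of 1/q^2 over the fractions of I,
    up to one boundary term. This is [S0_le].

    To bound G by (6/pi^2) |I| log Q + O(1) uniformly in I, it is multiplied by
    Z, the sum of 1/m^2 for m <= Q, instead of using Moebius inversion. In G Z,
    the terms 1/(m q)^2 with m q <= Q are regrouped according to n = m q. The
    fractions of I whose denominator divides n are distinct multiples of 1/n
    in I, so there are at most |I| n + 1 of them, and this part is at most
    |I| (1 + ... + 1/Q) + Z. The terms with m q > Q contribute
    O(|I| + log Q / Q). Dividing by Z, where Z >= pi^2/6 - 1/Q, gives
    [sum_inv_den_sqr_le]; the term Z of the numerator gives exactly 1, and so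
    the total error is about 3 + c|I|, well below 7.06 + 2.01|I|.

    That Z >= pi^2/6 - 1/Q follows from the identity
    1/sin^2 (x/2) + 1/cos^2 (x/2) = 4/sin^2 x, iterated from x = pi/4, combined
    with 1/x^2 <= 1/sin^2 x <= 1/x^2 + 1 on ]0, pi/2[. The same identity yields
    the numerical bound pi^2 >= 9.37, which makes the constants fit. *)

(** * The inverse squares and pi *)

Lemma sin_le_self (R : realType) (x : R) : 0 < x -> sin x <= x.
Proof.
move=> x0.
have [c _] : exists2 c, c \in `[0, x] & sin x - sin 0 = cos c * (x - 0).
  apply: (MVT_segment (ltW x0)).
  by apply: continuous_subspaceT => y; exact: continuous_sin.
rewrite sin0 !subr0 => ->.
by rewrite ler_piMl ?cos_le1 // ltW.
Qed.

Lemma self_le_tan (R : realType) (x : R) : 0 < x < pi / 2 -> x <= tan x.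
Proof.
move=> /andP[x0 xpi].
have cos_pos y : 0 <= y <= x -> 0 < cos y.
  move=> /andP[y0 yx]; apply: cos_gt0_pihalf.
  apply/andP; split; last exact: le_lt_trans yx xpi.
  by apply: lt_le_trans y0; rewrite oppr_lt0 divr_gt0 ?pi_gt0.
have [c c_in] :
    exists2 c, c \in `[0, x] & tan x - tan 0 = cos c ^- 2 * (x - 0).
  apply: (MVT_segment (df := fun y => cos y ^- 2) (ltW x0)) => [y|].
    rewrite in_itv /= => /andP[y0 yx]; apply: is_derive_tan.
    by rewrite gt_eqF // cos_pos // !ltW.
  apply: derivable_within_continuous => y; rewrite in_itv /= => yI.
  by apply: derivable_tan; rewrite gt_eqF // cos_pos.
rewrite tan0 !subr0 => ->.
have c0 : 0 < cos c by apply: cos_pos; move: c_in; rewrite in_itv.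
by rewrite ler_peMl ?(ltW x0) // invf_ge1 ?exprn_gt0.
Qed.

Lemma csc2_bounds (R : realType) (x : R) : 0 < x < pi / 2 ->
  (x ^+ 2)^-1 <= (sin x ^+ 2)^-1 <= (x ^+ 2)^-1 + 1.
Proof.
move=> xI; have /andP[x0 xpi] := xI.
have s0 : 0 < sin x by exact: sin_gt0_pihalf.
have c0 : 0 < cos x.
  apply: cos_gt0_pihalf; rewrite xpi andbT.
  by apply: lt_trans x0; rewrite oppr_lt0 divr_gt0 ?pi_gt0.
apply/andP; split.
  rewrite lef_pV2 ?posrE ?exprn_gt0 //.
  by rewrite ler_pXn2r ?nnegrE ?(ltW s0) ?(ltW x0) // sin_le_self.
have -> : (sin x ^+ 2)^-1 = (tan x ^+ 2)^-1 + 1.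
  rewrite -[LHS]mul1r -[X in X * _](cos2Dsin2 x) /tan.
  by field; rewrite !gt_eqF.
rewrite lerD2r lef_pV2 ?posrE ?exprn_gt0 ?divr_gt0 //.
by rewrite ler_pXn2r ?nnegrE ?(ltW x0) ?self_le_tan // ltW // divr_gt0.
Qed.

(** The two arguments are complementary halves, so that the second sine is
    cos (x / 2) and both arguments stay in ]0, pi/2[. *)
Lemma csc2_half (R : realType) (x : R) : 0 < x < pi / 2 ->
  (sin (x / 2) ^+ 2)^-1 + (sin (pi / 2 - x / 2) ^+ 2)^-1 = 4 * (sin x ^+ 2)^-1.
Proof.
move=> /andP[x0 xpi].
have h0 : 0 < sin (x / 2) by apply: sin_gt0_pihalf; lra.
have c0 : 0 < cos (x / 2) by apply: cos_gt0_pihalf; lra.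
have -> : sin (pi / 2 - x / 2) = cos (x / 2).
  by rewrite addrC sinDpihalf cosN.
have -> : sin x = 2 * (cos (x / 2) * sin (x / 2)).
  rewrite {1}(_ : x = (x / 2) *+ 2) ?sin_mulr2n ?mulr_natl //.
  by rewrite -mulr_natl; field.
have E := cos2Dsin2 (x / 2).
transitivity ((cos (x / 2) ^+ 2 + sin (x / 2) ^+ 2)
              / (cos (x / 2) * sin (x / 2)) ^+ 2).
  by field; rewrite !gt_eqF.
by rewrite E; field; rewrite !gt_eqF.
Qed.

(** The points obtained from pi/4 after n halvings x |-> x/2, pi/2 - x/2. *)
Definition half_angle (R : realType) (n k : nat) : R :=
  k.*2.+1%:R * pi / (2 ^ n.+2)%:R.

Lemma half_angle_bounds (R : realType) (n k : nat) : (k < 2 ^ n)%N ->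
  0 < half_angle R n k < pi / 2.
Proof.
move=> kn; rewrite /half_angle.
have p0 := pi_gt0 R.
have N0 : 0 < (2 ^ n.+2)%:R :> R by rewrite ltr0n expn_gt0.
apply/andP; split.
  by apply: divr_gt0 => //; apply: mulr_gt0; rewrite // ltr0n.
have : (k.*2.+1%:R * 2 : R) < (2 ^ n.+2)%:R.
  by rewrite -natrM ltr_nat !expnS; lia.
rewrite ltr_pdivrMr //; nra.
Qed.

(** Each angle of level n splits into two of level n + 1, namely those of
    indices k and 2^(n+1) - 1 - k, and the sum is multiplied by 4. *)
Lemma sum_csc2 (R : realType) (n : nat) :
  \sum_(0 <= k < 2 ^ n) (sin (half_angle R n k) ^+ 2)^-1 = 2 * 4 ^+ n.
Proof.
elim: n => [|n IHn].
  rewrite big_nat1 expr0 mulr1 /half_angle /= mul1r.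
  have c0 : 0 < sin (pi / 4) :> R.
    by apply: sin_gt0_pihalf; have := pi_gt0 R; lra.
  have E : sin (pi / 4) ^+ 2 = 1 / 2 :> R.
    have := cos2Dsin2 (pi / 4 : R).
    have <- : sin (pi / 4) = cos (pi / 4) :> R.
      by rewrite -cosN -sinDpihalf; congr sin; field.
    lra.
  by rewrite (_ : (2 ^ 2)%:R = 4 :> R) // E; field.
have e2 : (2 ^ n.+1 = 2 ^ n + 2 ^ n)%N by rewrite expnS mul2n addnn.
rewrite {1}e2 (@big_cat_nat _ _ _ (2 ^ n)) ?leq_addr //=.
rewrite -{2}[(2 ^ n)%N]add0n big_addn addnK.
rewrite [X in _ + X]big_nat_rev /= -big_split /=.
rewrite exprS mulrCA -IHn big_distrr /=.
apply: eq_big_nat => k /andP[_ kn].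
rewrite -csc2_half ?half_angle_bounds //.
congr ((sin _ ^+ 2)^-1 + (sin _ ^+ 2)^-1).
- rewrite /half_angle [in LHS]expnS natrM; field.
  by rewrite pnatr_eq0 expn_eq0.
- rewrite /half_angle [in LHS]expnS natrM.
  have -> : ((0 + 2 ^ n - k.+1 + 2 ^ n).*2.+1)%:R
      = (2 ^ n.+2)%:R / 2 * 2 - k.*2.+1%:R :> R.
    rewrite divfK ?pnatr_eq0 // -natrB; last by rewrite !expnS; lia.
    by congr (_%:R); rewrite !expnS; lia.
  field.
  by rewrite pnatr_eq0 expn_eq0.
Qed.

(** Replacing every 1/sin^2 x by 1/x^2 in the exact sum costs at most 1 per
    term, that is 2^n against a total of order 4^n. *)
Lemma sum_odd_inv_sqr_bounds (R : realType) (n : nat) :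
  \sum_(0 <= k < 2 ^ n) (k.*2.+1%:R ^+ 2)^-1 <= pi ^+ 2 / 8 :> R /\
  pi ^+ 2 / 8
    <= \sum_(0 <= k < 2 ^ n) (k.*2.+1%:R ^+ 2)^-1 + (2 ^ n)%:R^-1 :> R.
Proof.
set s := \sum_(_ <= _ < _) _.
have p0 := pi_gt0 R.
have N0 : 0 < (2 ^ n)%:R :> R by rewrite ltr0n expn_gt0.
have sumE : \sum_(0 <= k < 2 ^ n) (half_angle R n k ^+ 2)^-1 =
    16 * (2 ^ n)%:R ^+ 2 / pi ^+ 2 * s.
  rewrite /s big_distrr /=; apply: eq_big_nat => k _.
  rewrite /half_angle (_ : (2 ^ n.+2)%:R = 4 * (2 ^ n)%:R); last first.
    by rewrite -natrM; congr (_%:R); rewrite !expnS; lia.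
  have k0 : k.*2.+1%:R != 0 :> R by rewrite pnatr_eq0.
  by move: (k.*2.+1%:R) (pi) k0 p0 => x p x0 p0; field; rewrite x0 !gt_eqF.
have four : 4 ^+ n = (2 ^ n)%:R ^+ 2 :> R.
  by rewrite natrX -exprM mulnC exprM; congr (_ ^+ n); lra.
have lo : 16 * (2 ^ n)%:R ^+ 2 / pi ^+ 2 * s <= 2 * (2 ^ n)%:R ^+ 2.
  rewrite -sumE -four -sum_csc2 !big_nat; apply: ler_sum => k /andP[_ kn].
  by have /(csc2_bounds R)/andP[] := half_angle_bounds R _ _ kn.
have hi : 2 * (2 ^ n)%:R ^+ 2
    <= 16 * (2 ^ n)%:R ^+ 2 / pi ^+ 2 * s + (2 ^ n)%:R.
  rewrite -sumE -four -sum_csc2.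
  have -> : (2 ^ n)%:R = \sum_(0 <= k < 2 ^ n) 1 :> R.
    by rewrite sumr_const_nat subn0.
  rewrite -big_split /= !big_nat.
  apply: ler_sum => k /andP[_ kn].
  by have /(csc2_bounds R)/andP[] := half_angle_bounds R _ _ kn.
have p4 : pi ^+ 2 <= 16 :> R.
  have := pihalf_lt2 R; nra.
split.
  rewrite -(ler_pM2l (_ : 0 < 16 * (2 ^ n)%:R ^+ 2 / pi ^+ 2)); last first.
    by rewrite divr_gt0 ?mulr_gt0 ?exprn_gt0.
  apply: le_trans lo _; rewrite le_eqVlt; apply/orP; left; apply/eqP.
  by move: (pi) p0 => p p0; field; rewrite gt_eqF.
rewrite -lerBlDr.
rewrite -(ler_pM2l (_ : 0 < 16 * (2 ^ n)%:R ^+ 2 / pi ^+ 2)); last first.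
  by rewrite divr_gt0 ?mulr_gt0 ?exprn_gt0.
have -> : 16 * (2 ^ n)%:R ^+ 2 / pi ^+ 2 * (pi ^+ 2 / 8 - (2 ^ n)%:R^-1)
    = 2 * (2 ^ n)%:R ^+ 2 - 16 / pi ^+ 2 * (2 ^ n)%:R :> R.
  by move: (pi) p0 => p p0; field; rewrite !gt_eqF.
have : (2 ^ n)%:R <= 16 / pi ^+ 2 * (2 ^ n)%:R :> R.
  by rewrite ler_peMl ?(ltW N0) // ler_pdivlMr ?mul1r ?exprn_gt0.
lra.
Qed.

Lemma pi_sqr_ge (R : realType) : 937 / 100 <= pi ^+ 2 :> R.
Proof.
have [] := sum_odd_inv_sqr_bounds R 2.
have -> : \sum_(0 <= k < 2 ^ 2) (k.*2.+1%:R ^+ 2)^-1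
    = 1 + 9^-1 + 25^-1 + 49^-1 :> R.
  by rewrite /index_iota /= !big_cons big_nil /= !doubleS double0; field.
lra.
Qed.

(** Compare 1/m^2 with 1/(m-1) - 1/m. *)
Lemma sum_inv_sqr_tail (R : realType) (M N : nat) : (0 < M <= N)%N ->
  \sum_(M.+1 <= m < N.+1) (m%:R ^+ 2)^-1 <= M%:R^-1 :> R.
Proof.
move=> /andP[M0 MN].
have telescoped : \sum_(M.+1 <= m < N.+1) (m%:R ^+ 2)^-1
    <= M%:R^-1 - N%:R^-1 :> R.
  elim: N MN => [|N IHN]; first by case: M M0.
  rewrite leq_eqVlt => /orP[/eqP <-|MN]; first by rewrite big_geq // subrr.
  rewrite big_nat_recr //=.
  have Npos : (0 < N)%N by lia.
  have N0 : 0 < N%:R :> R by rewrite ltr0n.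
  have : (N.+1%:R ^+ 2)^-1 <= N%:R^-1 - N.+1%:R^-1 :> R.
    have -> : N%:R^-1 - N.+1%:R^-1 = (N%:R * N.+1%:R)^-1 :> R.
      rewrite -natr1; field; rewrite (gt_eqF N0) /= natr1 pnatr_eq0 //.
    rewrite lef_pV2 ?posrE ?mulr_gt0 ?exprn_gt0 ?ltr0n //.
    by rewrite expr2 ler_pM2r ?ltr0n // ler_nat.
  move=> step; apply: le_trans (lerD (IHN MN) step) _.
  by rewrite addrA subrK.
apply: le_trans telescoped _.
by rewrite gerBl invr_ge0.
Qed.

Lemma sum_inv_sqr_split (R : realType) (N : nat) :
  \sum_(1 <= m < N.*2.+1) (m%:R ^+ 2)^-1 =
  \sum_(0 <= k < N) (k.*2.+1%:R ^+ 2)^-1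
    + (\sum_(1 <= m < N.+1) (m%:R ^+ 2)^-1) / 4 :> R.
Proof.
elim: N => [|N IHN]; first by rewrite !big_geq // mul0r addr0.
rewrite doubleS big_nat_recr //= big_nat_recr //= IHN.
rewrite [in RHS]big_nat_recr //= [X in _ = _ + X / 4]big_nat_recr //=.
have -> : N.*2.+2%:R = 2 * N.+1%:R :> R by rewrite -natrM; congr (_%:R); lia.
have : N.+1%:R != 0 :> R by rewrite pnatr_eq0.
move: N.+1%:R (N.*2.+1%:R ^- 2) => x y x0.
by field; rewrite x0.
Qed.

(** The partial sums are within 1/Q of all later ones, and these come
    arbitrarily close to pi^2/6: with o and z the sums over the odd and over all
    m, one has o = z - z/4 in the limit, and o tends to pi^2/8. *)
Lemma sum_inv_sqr_ge (R : realType) (Q : nat) : (0 < Q)%N ->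
  pi ^+ 2 / 6 <= \sum_(1 <= m < Q.+1) (m%:R ^+ 2)^-1 + Q%:R^-1 :> R.
Proof.
move=> Q0; rewrite leNgt; apply/negP => lt_s.
set s := \sum_(_ <= _ < _) _ in lt_s.
set e := pi ^+ 2 / 6 - (s + Q%:R^-1).
have e0 : 0 < e by rewrite subr_gt0.
(* 2^n exceeds both Q and 2/e; the bounds below are off by less than 2/2^n. *)
pose n := (Q + Num.truncn (2 / e))%N.
have nN : (n < 2 ^ n)%N by exact: ltn_expl.
have N0 : 0 < (2 ^ n)%:R :> R by rewrite ltr0n expn_gt0.
have Ne : (2 ^ n)%:R^-1 * 2 < e.
  rewrite mulrC ltr_pdivrMr // mulrC -ltr_pdivrMr //.
  have := truncnS_gt (2 / e).
  move=> /lt_le_trans; apply; rewrite ler_nat.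
  by apply: leq_ltn_trans nN; exact: leq_addl.
have QN : (Q <= 2 ^ n)%N by apply: leq_trans (ltnW nN); exact: leq_addr.
have upto M : (Q <= M)%N ->
    \sum_(1 <= m < M.+1) (m%:R ^+ 2)^-1 <= s + Q%:R^-1 :> R.
  move=> QM; rewrite (@big_cat_nat _ _ _ Q.+1) //= lerD2l.
  by apply: sum_inv_sqr_tail; rewrite Q0.
have [_] := sum_odd_inv_sqr_bounds R n.
have := sum_inv_sqr_split R (2 ^ n).
have := upto (2 ^ n).*2.
have -> : (Q <= (2 ^ n).*2)%N.
  by rewrite -addnn; exact: leq_trans QN (leq_addr _ _).
move=> /(_ isT).
have : \sum_(1 <= m < (2 ^ n).*2.+1) (m%:R ^+ 2)^-1
    <= \sum_(1 <= m < (2 ^ n).+1) (m%:R ^+ 2)^-1 + (2 ^ n)%:R^-1 :> R.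
  rewrite (@big_cat_nat _ _ _ (2 ^ n).+1) //=; last by rewrite ltnS -addnn leq_addr.
  by rewrite lerD2l sum_inv_sqr_tail // expn_gt0 -addnn leq_addr.
move: Ne; rewrite /e; lra.
Qed.

(** * Consecutive Farey fractions *)

Lemma denq_frac_le (n d : int) : 0 < d -> denq (n%:Q / d%:Q) <= d.
Proof.
move=> d0; set z := _ / _.
have d0' : d%:Q != 0 by rewrite intr_eq0 gt_eqF.
have /(@intr_inj rat) E : (numq z * d)%:~R = (n * denq z)%:~R :> rat.
  by rewrite !intrM numqE mulrAC divfK.
have : (denq z %| numq z * d)%Z by rewrite E dvdz_mull.
rewrite Gauss_dvdzr; last by rewrite coprimez_sym; exact: coprime_num_den.
rewrite dvdzE => /dvdn_leq; have := denq_gt0 z; lia.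
Qed.

Lemma subq_frac (x y : rat) :
  y - x = (numq y * denq x - numq x * denq y)%:~R / (denq x * denq y)%:~R.
Proof.
rewrite -{1}(divq_num_den x) -{1}(divq_num_den y) !(rmorphM, rmorphB) /=.
by field; rewrite !intr_eq0 !denq_neq0.
Qed.

(** Adjacency is phrased in all of the rationals, so that the periodic extension
    needs no separate treatment. *)
Definition farey_adjacent (Q : nat) (x y : rat) : Prop :=
  [/\ denq x <= Q%:Z, denq y <= Q%:Z, x < y &
      forall z : rat, denq z <= Q%:Z -> x < z -> y <= z].

(** The Bezout relation determines q modulo the denominator of x, so q can be
    taken in the last full period below Q. *)
Lemma bezout_neighbour (Q : nat) (x : rat) : denq x <= Q%:Z ->
  exists a q : int,
    [/\ a * denq x - numq x * q = 1, q <= Q%:Z & Q%:Z < q + denq x].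
Proof.
move=> xQ; have [u [v uv]] := Bezoutz (numq x) (denq x).
have g1 : gcdz (numq x) (denq x) = 1.
  by apply/eqP; exact: (coprime_num_den x).
rewrite g1 in uv.
set t := ((Q%:Z + u) %/ denq x)%Z; set r := ((Q%:Z + u) %% denq x)%Z.
have E : Q%:Z + u = t * denq x + r by exact: divz_eq.
exists (v + t * numq x), (Q%:Z - r); split.
- rewrite (_ : Q%:Z - r = t * denq x - u); last first.
    by rewrite -[Q%:Z](addrK u) E; ring.
  by rewrite -uv; ring.
- by rewrite gerBl modz_ge0.
- have := ltz_pmod (Q%:Z + u) (denq_gt0 x); rewrite -/r; lia.
Qed.

(** The fraction z = a/q given by Bezout has y <= z. If y < z, then z - x is the
    sum of two gaps, and clearing denominators forces the denominator of y to be
    at least q + denq x > Q. Hence y = z. *)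
Lemma farey_adjacent_gap (Q : nat) (x y : rat) : farey_adjacent Q x y ->
  y - x = ((denq x * denq y)%:~R)^-1 /\ Q%:Z < denq x + denq y.
Proof.
move=> [xQ yQ xy y_min].
have [a [q [det_xz qQ Qq]]] := bezout_neighbour Q x xQ.
have q0 : 0 < q by lia.
have dx := denq_gt0 x; have dy := denq_gt0 y.
pose z : rat := a%:~R / q%:~R.
have zx : z - x = (denq x * q)%:~R^-1.
  have one : 1 = (a * denq x - numq x * q)%:~R :> rat by rewrite det_xz.
  rewrite /z -{1}(divq_num_den x) -[RHS]mul1r [X in _ = X * _]one.
  rewrite !(rmorphM, rmorphB) /=.
  by field; rewrite !intr_eq0 denq_neq0 gt_eqF.
have zQ : denq z <= q by exact: denq_frac_le.
have yz : y <= z.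
  apply: y_min; first exact: le_trans zQ qQ.
  by rewrite -subr_gt0 zx invr_gt0 ltr0z mulr_gt0.
have det_xy : 1 <= numq y * denq x - numq x * denq y.
  rewrite -gtz0_ge1.
  move: xy; rewrite -subr_gt0 subq_frac pmulr_lgt0 ?ltr0z //.
  by rewrite invr_gt0 ltr0z mulr_gt0.
have det_yz : 0 <= a * denq y - numq y * q.
  move: yz; rewrite -subr_ge0 /z -{1}(divq_num_den y).
  have -> : a%:~R / q%:~R - (numq y)%:~R / (denq y)%:~R
     = (a * denq y - numq y * q)%:~R / (q * denq y)%:~R :> rat.
    rewrite !(rmorphM, rmorphB) /=.
    by field; rewrite !intr_eq0 denq_neq0 gt_eqF.
  by rewrite pmulr_lge0 ?ler0z // invr_gt0 ltr0z mulr_gt0.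
have comb : q * (numq y * denq x - numq x * denq y)
    + denq x * (a * denq y - numq y * q) = denq y.
  by rewrite -[RHS]mulr1 -det_xz; ring.
have det_yz0 : a * denq y - numq y * q = 0 by nia.
have zy : z = y.
  rewrite /z -(divq_num_den y); apply/eqP.
  by rewrite eqr_div ?intr_eq0 ?denq_neq0 ?(gt_eqF q0) // -!intrM eqr_int; lia.
have yq : denq y = q by move: zQ; rewrite zy; nia.
by rewrite yq -zy zx; split => //; lia.
Qed.

Lemma mem_farey (Q : nat) (x : rat) :
  (x \in farey Q) = (0 < x <= 1) && (denq x <= Q%:Z).
Proof.
rewrite /farey mem_sort mem_undup; apply/allpairsPdep/idP.
  move=> [q [a [/[!mem_iota] /andP[q1 qQ]]]].
  rewrite mem_filter mem_iota => /andP[aq /andP[a1 a2]] ->.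
  have q0 : (0 < q%:R :> rat) by rewrite ltr0n.
  rewrite divr_gt0 ?ltr0n //= ler_pdivrMr // mul1r ler_nat.
  rewrite -ltnS -[q.+1]add1n a2 /=.
  have := @denq_frac_le a%:Z q%:Z; rewrite ltz_nat => /(_ q1) /le_trans; apply.
  by rewrite lez_nat; lia.
move=> /andP[/andP[x0 x1] xQ].
have dx := denq_gt0 x; have nx : 0 < numq x by rewrite numq_gt0.
have nd : numq x <= denq x.
  by rewrite -(ler_int rat) numqE ler_piMl // ler0z ltW.
exists `|denq x|%N, `|numq x|%N; split.
- by rewrite mem_iota; lia.
- by rewrite mem_filter coprime_num_den mem_iota; lia.
- by rewrite -[LHS]divq_num_den !natr_absz !gtr0_norm.
Qed.

Lemma farey_uniq (Q : nat) : uniq (farey Q).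
Proof. by rewrite sort_uniq undup_uniq. Qed.

Lemma farey_sorted (Q : nat) : sorted <%R (farey Q).
Proof. by rewrite lt_sorted_uniq_le farey_uniq sort_le_sorted. Qed.

Lemma gamma_nth (Q j : nat) : (j < size (farey Q))%N ->
  gamma Q (j%:Z + 1) = nth 0 (farey Q) j.
Proof.
move=> jN; have jI : 0 <= j%:Z < (size (farey Q))%:Z by lia.
by rewrite /gamma addrK modz_small // divz_small ?addr0.
Qed.

Lemma gamma_wrap (Q : nat) : (0 < size (farey Q))%N ->
  gamma Q ((size (farey Q))%:Z + 1) = nth 0 (farey Q) 0 + 1.
Proof.
move=> N0; rewrite /gamma addrK modzz divzz.
by rewrite eqz_nat gtn_eqF.
Qed.

Lemma farey1 (Q : nat) : (0 < Q)%N -> 1 \in farey Q.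
Proof. by move=> Q0; rewrite mem_farey ltr01 lexx /= (denq_int 1); lia. Qed.

Lemma denqD1 (x : rat) : denq (x + 1) <= denq x.
Proof.
rewrite -{1}(divq_num_den x).
have -> : (numq x)%:~R / (denq x)%:~R + 1
    = (numq x + denq x)%:~R / (denq x)%:~R :> rat.
  by rewrite intrD mulrDl divff // intr_eq0 denq_neq0.
exact: denq_frac_le.
Qed.

Lemma denqB1 (x : rat) : denq (x - 1) <= denq x.
Proof. by rewrite -denqN opprB addrC -(denqN x) denqD1. Qed.

Lemma gamma_adjacent (Q i : nat) : (0 < Q)%N -> (i < size (farey Q))%N ->
  farey_adjacent Q (nth 0 (farey Q) i) (gamma Q (i.+1%:Z + 1)).
Proof.
move=> Q0 iN; set s := farey Q.
have nthF k : (k < size s)%N -> 0 < nth 0 s k <= 1 /\ denq (nth 0 s k) <= Q%:Z.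
  by move=> kN; apply/andP; rewrite -mem_farey mem_nth.
have lt_nth := lt_sorted_ltn_nth 0 (farey_sorted Q).
have le_nth := lt_sorted_leq_nth 0 (farey_sorted Q).
have [/andP[x0 x1] xQ] := nthF i iN.
have above z : denq z <= Q%:Z -> nth 0 s i < z -> z <= 1 ->
    exists2 k, (i < k < size s)%N & z = nth 0 s k.
  move=> zQ xz z1.
  have zs : z \in s by rewrite mem_farey (lt_trans x0 xz) z1 zQ.
  have kN : (index z s < size s)%N by rewrite index_mem.
  exists (index z s); last by rewrite nth_index.
  by rewrite kN andbT -lt_nth ?inE // nth_index.
have [iN1|] := ltnP i.+1 (size s).
  have [/andP[y0 y1] yQ] := nthF _ iN1.
  rewrite gamma_nth //; split=> //; first by rewrite lt_nth ?inE.
  move=> z zQ xz; have [z1|z1] := leP z 1; last exact: le_trans y1 (ltW z1).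
  have [k /andP[ik kN] ->] := above z zQ xz z1.
  by rewrite le_nth ?inE.
rewrite leq_eqVlt ltnNge iN orbF => /eqP Ni.
rewrite -Ni gamma_wrap; last exact: leq_ltn_trans iN.
have N0 : (0 < size s)%N by exact: leq_ltn_trans iN.
have [/andP[y0 y1] yQ] := nthF _ N0.
have x_eq1 : nth 0 s i = 1.
  apply: le_anti; rewrite x1 /=.
  have k1 := farey1 Q Q0.
  rewrite -(nth_index 0 k1) le_nth ?inE ?index_mem //.
  by rewrite -ltnS -Ni index_mem.
rewrite x_eq1; split.
- by rewrite -x_eq1.
- exact: le_trans (denqD1 _) yQ.
- by rewrite ltrDr.
move=> z zQ z1; rewrite -lerBrDr.
have [z2|z2] := leP z 2; last by lra.
have zs : z - 1 \in s.
  rewrite mem_farey subr_gt0 z1 (le_trans (denqB1 z)) // andbT; lra.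
by rewrite -(nth_index 0 zs) le_nth ?inE ?index_mem.
Qed.

(** * Counting fractions by denominator *)

Lemma natr_mul_of_denq_dvd (x : rat) (n : nat) : 0 <= x -> (`|denq x| %| n)%N ->
  x * n%:R = (Num.truncn (x * n%:R))%:R.
Proof.
move=> x0 /dvdnP[c ->]; rewrite natrM.
have -> : x * (c%:R * `|denq x|%:R) = (c * `|numq x|)%:R.
  by rewrite natrM !natr_absz normr_denq ger0_norm ?numq_ge0 // numqE; ring.
by rewrite natrK.
Qed.

(** Multiplication by n maps these fractions injectively to the integers in
    ]alpha n, beta n]. *)
Lemma size_multiples_le (R : realType) (alpha beta : R) (n : nat)
    (s : seq rat) :
  0 <= alpha < beta -> (0 < n)%N -> uniq s ->
  {in s, forall x, alpha < ratr x <= beta /\ (`|denq x| %| n)%N} ->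
  (size s)%:R <= (beta - alpha) * n%:R + 1.
Proof.
move=> /andP[a0 ab] n0 us sP.
have b0 : 0 <= beta by exact: le_trans (ltW ab).
have n0' : 0 < n%:R :> R by rewrite ltr0n.
pose f (x : rat) := Num.truncn (x * n%:R).
have fE x : x \in s -> x * n%:R = (f x)%:R.
  move=> /sP[/andP[ax _] dn]; apply: natr_mul_of_denq_dvd => //.
  by rewrite -(ler0q R); exact: ltW (le_lt_trans a0 ax).
have fR x : x \in s -> ratr x * n%:R = (f x)%:R :> R.
  by move=> xs; rewrite -(ratr_nat R n) -rmorphM /= fE // ratr_nat.
have /andP[ta_le ta_gt] := truncn_itv (mulr_ge0 a0 (ltW n0')).
have /andP[tb_le tb_gt] := truncn_itv (mulr_ge0 b0 (ltW n0')).
set ta := Num.truncn _ in ta_le ta_gt; set tb := Num.truncn _ in tb_le tb_gt.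
have tab : (ta <= tb)%N by rewrite /ta /tb le_truncn // ler_pM2r // ltW.
have : (size s <= tb - ta)%N.
  rewrite -(size_map f s) -[leqRHS](size_iota ta.+1); apply: uniq_leq_size.
    rewrite map_inj_in_uniq // => x y xs ys /(congr1 (GRing.natmul (1 : rat))).
    rewrite -!fE // => /mulIf; apply.
    by rewrite pnatr_eq0 -lt0n.
  move=> _ /mapP[x xs ->]; have [/andP[ax xb] _] := sP x xs.
  rewrite mem_iota addSn subnKC // -(ltr_nat R) -fR // ltnS.
  rewrite [(f x <= tb)%N]truncn_ge_nat ?mulr_ge0 ?(ltW n0') // -fR //.
  by rewrite ler_pM2r // xb andbT (le_lt_trans ta_le) // ltr_pM2r.
rewrite -(ler_nat R) natrB // => le_s; apply: le_trans le_s _.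
rewrite -natr1 in ta_gt; lra.
Qed.

Lemma sum_multiples (R : realType) (F : nat -> R) (Q d : nat) : (0 < d)%N ->
  \sum_(1 <= m < (Q %/ d).+1) F (m * d)%N =
  \sum_(1 <= n < Q.+1 | (d %| n)%N) F n.
Proof.
move=> d0; elim: Q => [|Q IHQ]; first by rewrite div0n !big_geq.
rewrite divnS // [in RHS]big_mkcond big_nat_recr //= -big_mkcond -IHQ.
case: ifP => dQ; last by rewrite add0n addr0.
rewrite add1n big_nat_recr //=; congr (_ + F _).
by have := divnS Q d0; rewrite dQ add1n => <-; rewrite divnK.
Qed.

Definition harmonic_sum (R : realType) (Q : nat) : R :=
  \sum_(1 <= n < Q.+1) n%:R^-1.

Lemma harmonic_sum_le (R : realType) (Q : nat) : (0 < Q)%N ->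
  harmonic_sum R Q <= 1 + ln Q%:R.
Proof.
rewrite /harmonic_sum; case: Q => // Q _; elim: Q => [|Q IHQ].
  by rewrite big_nat1 invr1 ln1 addr0.
rewrite big_nat_recr //=.
have q0 : 0 < Q.+1%:R :> R by rewrite ltr0n.
have q1 : 0 < Q.+2%:R :> R by rewrite ltr0n.
have step : ln (Q.+1%:R / Q.+2%:R) <= - Q.+2%:R^-1 :> R.
  have -> : Q.+1%:R / Q.+2%:R = 1 + - Q.+2%:R^-1 :> R.
    have Q2 : Q.+1%:R = Q.+2%:R - 1 :> R by rewrite -[Q.+2%:R]natr1 addrK.
    by rewrite Q2 mulrBl mul1r divff // gt_eqF.
  by apply: le_ln1Dx; rewrite ltrN2 invf_lt1 // ltr1n.
rewrite ln_div ?posrE // in step.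
have {}step : Q.+2%:R^-1 <= ln Q.+2%:R - ln Q.+1%:R :> R.
  by rewrite -lerN2 opprB.
apply: le_trans (lerD IHQ step) _.
by rewrite -addrA [ln Q.+1%:R + _]addrC subrK.
Qed.

Lemma exchange_sum_count (R : realType) (T : eqType) (s : seq T)
    (p : T -> nat -> bool)
    (F : nat -> R) (Q : nat) :
  \sum_(x <- s) \sum_(1 <= n < Q.+1 | p x n) F n =
  \sum_(1 <= n < Q.+1) F n * (size [seq x <- s | p x n])%:R.
Proof.
under eq_bigr do rewrite big_mkcond.
rewrite exchange_big /=; apply: eq_bigr => n _.
by rewrite -big_mkcond /= big_const_seq iter_addr_0 size_filter mulr_natr.
Qed.

Definition farey_in (R : realType) (Q : nat) (alpha beta : R) : seq rat :=
  [seq x <- farey Q | alpha < ratr x <= beta].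

Definition den (x : rat) : nat := `|denq x|%N.

Lemma den_bounds (R : realType) (Q : nat) (alpha beta : R) (x : rat) :
  x \in farey_in R Q alpha beta -> (0 < den x <= Q)%N.
Proof.
rewrite mem_filter mem_farey => /andP[_ /andP[_ dQ]].
by have := denq_gt0 x; rewrite /den; lia.
Qed.

(** All denominators dividing n are taken together: the error is then 1, whereas
    comparing the count for the single denominator n with |I| phi(n) has an
    error that may grow with the number of prime factors of n. *)
Lemma size_den_dvd_le (R : realType) (Q : nat) (alpha beta : R) (n : nat) :
  0 <= alpha < beta -> (0 < n)%N ->
  (size [seq x <- farey_in R Q alpha beta | (den x %| n)%N])%:R
    <= (beta - alpha) * n%:R + 1.
Proof.
move=> ab n0; apply: size_multiples_le => //.
  by rewrite !filter_uniq // farey_uniq.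
by move=> x; rewrite !mem_filter => /andP[-> /andP[-> _]].
Qed.

Lemma size_den_eq_le (R : realType) (Q : nat) (alpha beta : R) (n : nat) :
  0 <= alpha < beta -> (0 < n)%N ->
  (size [seq x <- farey_in R Q alpha beta | n == den x])%:R
    <= (beta - alpha) * n%:R + 1.
Proof.
move=> ab n0; apply: le_trans (size_den_dvd_le R Q _ _ n ab n0).
rewrite ler_nat !size_filter.
by apply: sub_count => x /= /eqP ->.
Qed.

Lemma sum_by_den (R : realType) (Q : nat) (alpha beta : R) (F : nat -> R) :
  \sum_(x <- farey_in R Q alpha beta) F (den x) =
  \sum_(1 <= n < Q.+1)
     F n * (size [seq x <- farey_in R Q alpha beta | n == den x])%:R.
Proof.
rewrite -exchange_sum_count; apply: eq_big_seq => x xs.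
have /andP[d0 dQ] := den_bounds _ _ _ _ _ xs.
rewrite -big_filter filter_pred1_uniq ?iota_uniq ?big_seq1 //.
by rewrite mem_index_iota ltnS d0.
Qed.

Lemma sum_den_sqr_head (R : realType) (Q : nat) (alpha beta : R) :
  0 <= alpha < beta ->
  \sum_(x <- farey_in R Q alpha beta)
     \sum_(1 <= m < (Q %/ den x).+1) ((m * den x)%:R ^+ 2)^-1
  <= (beta - alpha) * harmonic_sum R Q + \sum_(1 <= n < Q.+1) (n%:R ^+ 2)^-1.
Proof.
move=> ab; pose F n : R := (n%:R ^+ 2)^-1.
rewrite (eq_big_seq (fun x => \sum_(1 <= n < Q.+1 | (den x %| n)%N) F n));
  last first.
  move=> x /den_bounds/andP[d0 _]; exact: (sum_multiples R F).
rewrite (exchange_sum_count R _ _ (fun x n => (den x %| n)%N)).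
rewrite /harmonic_sum big_distrr /= -big_split /= !big_nat.
apply: ler_sum => n /andP[n0 _].
have n0' : 0 < n%:R :> R by rewrite ltr0n.
have F0 : 0 < F n by rewrite invr_gt0 exprn_gt0.
apply: le_trans (ler_wpM2l (ltW F0) (size_den_dvd_le R Q _ _ n ab n0)) _.
rewrite /F le_eqVlt; apply/orP; left; apply/eqP; field.
by rewrite gt_eqF.
Qed.

Lemma sum_den_inv_le (R : realType) (Q : nat) (alpha beta : R) :
  0 <= alpha < beta ->
  \sum_(x <- farey_in R Q alpha beta) (den x)%:R^-1
  <= (beta - alpha) * Q%:R + harmonic_sum R Q.
Proof.
move=> ab; rewrite (sum_by_den R Q alpha beta (fun n => n%:R^-1)).
have -> : Q%:R = \sum_(1 <= n < Q.+1) 1 :> R by rewrite sumr_const_nat subn1.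
rewrite /harmonic_sum big_distrr /= -big_split /= !big_nat.
apply: ler_sum => n /andP[n0 _].
have n0' : 0 < n%:R :> R by rewrite ltr0n.
have F0 : 0 < n%:R^-1 :> R by rewrite invr_gt0.
apply: le_trans (ler_wpM2l (ltW F0) (size_den_eq_le R Q _ _ n ab n0)) _.
rewrite le_eqVlt; apply/orP; left; apply/eqP; field.
by rewrite gt_eqF.
Qed.

(** For a denominator q the inner sum is at most 1/(q^2 k) with k the integral
    part of Q/q, and Q <= 2 k q because k >= 1. What remains is a multiple of
    the sum of 1/q over the fractions. *)
Lemma sum_den_sqr_tail (R : realType) (Q : nat) (alpha beta : R) :
  0 <= alpha < beta ->
  \sum_(x <- farey_in R Q alpha beta)
     \sum_((Q %/ den x).+1 <= m < Q.+1) ((m * den x)%:R ^+ 2)^-1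
  <= 2 * (beta - alpha) + 2 * harmonic_sum R Q / Q%:R.
Proof.
move=> ab.
have [->|Q0] := posnP Q.
  rewrite big1 => [|x _]; last by rewrite div0n big_geq.
  rewrite /harmonic_sum big_geq // mulr0 mul0r addr0.
  by case/andP: ab => _ ab; lra.
have Q0' : 0 < Q%:R :> R by rewrite ltr0n.
suff le_x x : x \in farey_in R Q alpha beta ->
    \sum_((Q %/ den x).+1 <= m < Q.+1) ((m * den x)%:R ^+ 2)^-1
      <= 2 / Q%:R * (den x)%:R^-1 :> R.
  rewrite big_seq; apply: le_trans (ler_sum _ le_x) _.
  rewrite -big_seq -big_distrr /=.
  have c0 : 0 <= 2 / Q%:R :> R by rewrite divr_ge0 // ltW.
  apply: le_trans (ler_wpM2l c0 (sum_den_inv_le R Q _ _ ab)) _.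
  rewrite le_eqVlt; apply/orP; left; apply/eqP; field.
  by rewrite gt_eqF.
move=> /den_bounds/andP[d0 dQ]; set k := (Q %/ den x)%N.
have k0 : (0 < k)%N by rewrite divn_gt0.
have d0' : 0 < (den x)%:R :> R by rewrite ltr0n.
have k0' : 0 < k%:R :> R by rewrite ltr0n.
have kQ : Q%:R <= 2 * k%:R * (den x)%:R :> R.
  rewrite -!natrM ler_nat.
  have := ltn_ceil Q d0; rewrite -/k; nia.
have -> : \sum_(k.+1 <= m < Q.+1) ((m * den x)%:R ^+ 2)^-1
    = ((den x)%:R ^+ 2)^-1 * \sum_(k.+1 <= m < Q.+1) (m%:R ^+ 2)^-1 :> R.
  rewrite big_distrr /=; apply: eq_big_nat => m _.
  by rewrite natrM exprMn invfM mulrC.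
have dd0 : 0 <= ((den x)%:R ^+ 2)^-1 :> R by rewrite invr_ge0 exprn_ge0 // ltW.
apply: le_trans (ler_wpM2l dd0 (sum_inv_sqr_tail R k Q _)) _.
  by rewrite k0 leq_div.
rewrite -subr_ge0.
have -> : 2 / Q%:R * (den x)%:R^-1 - (den x)%:R ^- 2 / k%:R
   = (2 * k%:R * (den x)%:R - Q%:R) / (Q%:R * (den x)%:R ^+ 2 * k%:R) :> R.
  by field; rewrite !gt_eqF.
by rewrite divr_ge0 ?subr_ge0 // ltW // !mulr_gt0.
Qed.

(** From G Z <= |I| (H + 2) + 2 H/Q + Z one gets
    (G - 1) Z <= |I| (H + 2) + 2 H/Q. Keeping G - 1 together makes the additive
    error 1 independent of the size of Z; replacing Z by pi^2/6 - 1/Q then costs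
    G/Q <= 2 H/Q. *)
Lemma sum_inv_den_sqr_le (R : realType) (Q : nat) (alpha beta : R) :
  (0 < Q)%N -> 0 <= alpha < beta -> beta <= 1 ->
  \sum_(x <- farey_in R Q alpha beta) ((den x)%:R ^+ 2)^-1
  <= 1 + 6 / pi ^+ 2 * ((beta - alpha) * (harmonic_sum R Q + 2)
                        + 4 * harmonic_sum R Q / Q%:R).
Proof.
move=> Q0 ab b1.
set G := \sum_(x <- _) _; set D := beta - alpha; set H := harmonic_sum R Q.
pose Z : R := \sum_(1 <= m < Q.+1) (m%:R ^+ 2)^-1.
have Q0' : 0 < Q%:R :> R by rewrite ltr0n.
have D0 : 0 < D by rewrite subr_gt0; case/andP: ab.
have D1 : D <= 1 by move: ab b1; rewrite /D; lra.
have H0 : 0 <= H by apply: sumr_ge0 => n _; rewrite invr_ge0.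
have p0 : 0 < pi ^+ 2 :> R by rewrite exprn_gt0 ?pi_gt0.
have ZH : Z <= H.
  rewrite /Z /H /harmonic_sum !big_nat; apply: ler_sum => n /andP[n0 _].
  have n0' : 0 < n%:R :> R by rewrite ltr0n.
  rewrite lef_pV2 ?posrE ?exprn_gt0 // expr2 ler_peMl ?(ltW n0') //.
  by rewrite ler1n.
have GH : G <= 2 * H.
  rewrite /G (sum_by_den R Q alpha beta (fun n => (n%:R ^+ 2)^-1)).
  apply: (@le_trans _ _ (D * H + Z)); last by nra.
  rewrite /H /Z /harmonic_sum big_distrr /= -big_split /= !big_nat.
  apply: ler_sum => n /andP[n0 _].
  have n0' : 0 < n%:R :> R by rewrite ltr0n.
  have F0 : 0 <= (n%:R ^+ 2)^-1 :> R by rewrite invr_ge0 exprn_ge0 // ltW.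
  apply: le_trans (ler_wpM2l F0 (size_den_eq_le R Q _ _ n ab n0)) _.
  rewrite le_eqVlt; apply/orP; left; apply/eqP; rewrite -/D; field.
  by rewrite gt_eqF.
have GZ : G * Z <= D * (H + 2) + 2 * H / Q%:R + Z.
  have -> : G * Z = \sum_(x <- farey_in R Q alpha beta)
      \sum_(1 <= m < Q.+1) ((m * den x)%:R ^+ 2)^-1.
    rewrite /G big_distrl; apply: eq_bigr => x _ /=.
    rewrite big_distrr; apply: eq_bigr => m _ /=.
    by rewrite natrM exprMn [RHS]invfM mulrC.
  rewrite (eq_big_seq (fun x =>
    \sum_(1 <= m < (Q %/ den x).+1) ((m * den x)%:R ^+ 2)^-1 +
    \sum_((Q %/ den x).+1 <= m < Q.+1) ((m * den x)%:R ^+ 2)^-1)); last first.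
    by move=> x _; rewrite -big_cat_nat //= ltnS leq_div.
  rewrite big_split /=.
  have := sum_den_sqr_head R Q alpha beta ab.
  have := sum_den_sqr_tail R Q alpha beta ab.
  rewrite -/D -/H -/Z; lra.
have rhs0 : 0 <= D * (H + 2) + 4 * H / Q%:R.
  have HQ0 : 0 <= 4 * H / Q%:R by rewrite divr_ge0 ?mulr_ge0 // ltW.
  by apply: addr_ge0 => //; apply: mulr_ge0; lra.
rewrite addrC -lerBlDr.
have [G1|G1] := leP G 1.
  apply: (@le_trans _ _ 0); first by rewrite subr_le0.
  by rewrite mulr_ge0 // divr_ge0 // ltW.
rewrite mulrAC ler_pdivlMr // mulrC -ler_pdivrMl // mulrA mulrAC.
have ZQ := sum_inv_sqr_ge R Q Q0; rewrite -/Z in ZQ.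
have G10 : 0 <= G - 1 by rewrite subr_ge0 ltW.
have := ler_wpM2l G10 ZQ.
have : (G - 1) * Q%:R^-1 <= 2 * H / Q%:R.
  by rewrite ler_wpM2r ?invr_ge0 ?(ltW Q0') //; lra.
have -> : 4 * H / Q%:R = 2 * H / Q%:R + 2 * H / Q%:R.
  by rewrite -mulrDl; congr (_ / _); ring.
lra.
Qed.

(** * Summation over an interval *)

Lemma convex_pred_interval (P : pred nat) (N : nat) :
  (forall i j k, (i <= j <= k)%N -> (k < N)%N -> P i -> P k -> P j) ->
  exists a b, (a <= b <= N)%N /\ forall i, (i < N)%N -> P i = (a <= i < b)%N.
Proof.
elim: N => [|N IHN] Pconv; first by exists 0%N, 0%N.
have [|a [b [/andP[ab bN] PE]]] := IHN.
  by move=> i j k ijk kN; apply: Pconv ijk _; exact: ltnW.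
have [PN|PN] := boolP (P N); last first.
  exists a, b; split=> [|i]; first by rewrite ab ltnW.
  rewrite ltnS leq_eqVlt => /orP[/eqP ->|]; last exact: PE.
  by rewrite (negbTE PN) ltnNge bN andbF.
have [ab_eq|ab_lt] := leqP b a.
  exists N, N.+1; split=> [|i]; first by rewrite leqnSn leqnn.
  move=> iN1; have [->|iN] := eqVneq i N; first by rewrite PN leqnn leqnn.
  by rewrite PE; lia.
exists a, N.+1; split=> [|i]; first by rewrite leqnn andbT; lia.
rewrite !ltnS => iN; rewrite iN andbT; apply/idP/idP => [Pi|ai].
  move: iN; rewrite leq_eqVlt => /orP[/eqP ->|iN]; first by lia.
  by move: Pi; rewrite PE // => /andP[].
apply: (Pconv a i N); rewrite ?ai //.
by rewrite PE ?leqnn // (leq_trans ab_lt).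
Qed.

Lemma big_nat_interval (R : nmodType) (P : pred nat) (N a b : nat)
    (F : nat -> R) :
  (a <= b <= N)%N -> (forall i, (i < N)%N -> P i = (a <= i < b)%N) ->
  \sum_(0 <= i < N | P i) F i = \sum_(a <= i < b) F i.
Proof.
move=> /andP[ab bN] PE.
rewrite [RHS](big_nat_widen _ _ N) // [RHS](big_nat_widenl _ 0%N) //.
rewrite [LHS]big_nat_cond [RHS]big_nat_cond; apply: eq_bigl => i /=.
by have [iN|//] := ltnP i N; rewrite PE //= andbC.
Qed.

(** Both parts come from Q < q + q': the first since q + q' <= q q' + 1, the
    second by expanding Q^2 <= (q + q')^2. *)
Lemma farey_adjacent_sqr_gap (Q : nat) (x y : rat) : (0 < Q)%N ->
  farey_adjacent Q x y ->
  y - x <= Q%:R^-1 /\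
  Q%:R ^+ 2 * (y - x) ^+ 2 <=
    ((den x)%:R ^+ 2)^-1 + ((den y)%:R ^+ 2)^-1 + 2 * (y - x).
Proof.
move=> Q0 /farey_adjacent_gap[-> Qlt].
have dx := denq_gt0 x; have dy := denq_gt0 y.
have qx : (denq x)%:~R = (den x)%:R :> rat by rewrite natr_absz gtr0_norm.
have qy : (denq y)%:~R = (den y)%:R :> rat by rewrite natr_absz gtr0_norm.
rewrite intrM qx qy.
have x0 : (0 < den x)%N by rewrite /den; lia.
have y0 : (0 < den y)%N by rewrite /den; lia.
have {}Qlt : (Q < den x + den y)%N by rewrite /den; lia.
have x0' : 0 < (den x)%:R :> rat by rewrite ltr0n.
have y0' : 0 < (den y)%:R :> rat by rewrite ltr0n.
have Q0' : 0 < Q%:R :> rat by rewrite ltr0n.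
split.
  rewrite lef_pV2 ?posrE ?mulr_gt0 // -natrM ler_nat; nia.
have -> : ((den x)%:R ^+ 2)^-1 + ((den y)%:R ^+ 2)^-1
      + 2 * ((den x)%:R * (den y)%:R)^-1
    = ((den x)%:R + (den y)%:R) ^+ 2 * ((den x)%:R * (den y)%:R)^-1 ^+ 2 :> rat.
  by field; rewrite !gt_eqF.
rewrite ler_pM2r; last by rewrite exprn_gt0 // invr_gt0 mulr_gt0.
by rewrite ler_pXn2r ?nnegrE ?addr_ge0 // -?natrD ?ler_nat ?ler0n // ltnW.
Qed.

(** The indices of the fractions in I are consecutive, so the sums of
    differences telescope. The last successor may lie outside I: it accounts
    for the terms 1 and 2/Q. *)
Lemma S0_le (R : realType) (Q : nat) (alpha beta : R) : (0 < Q)%N ->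
  alpha < beta ->
  Q%:R ^+ 2 * S0 Q `]alpha, beta] <=
    2 * \sum_(x <- farey_in R Q alpha beta) ((den x)%:R ^+ 2)^-1
    + 2 * (beta - alpha) + 1 + 2 / Q%:R.
Proof.
move=> Q0 ab; set N := size (farey Q).
have Q0' : 0 < Q%:R :> R by rewrite ltr0n.
pose g i := gamma Q (i%:Z + 1).
pose r i : R := ratr (g i).
pose u i : R := ((den (g i))%:R ^+ 2)^-1.
pose P i := alpha < r i <= beta.
have g_nth i : (i < N)%N -> g i = nth 0 (farey Q) i by exact: gamma_nth.
have g_adj i : (i < N)%N -> farey_adjacent Q (g i) (g i.+1).
  by move=> iN; rewrite g_nth //; exact: gamma_adjacent.
have u01 i : 0 <= u i <= 1.
  have d0 : (0 < den (g i))%N by have := denq_gt0 (g i); rewrite /den; lia.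
  rewrite /u invr_ge0 exprn_ge0 // invf_le1 ?exprn_gt0 ?ltr0n //.
  by rewrite exprn_ege1 // ler1n.
have r_lt i j : (i < j < N)%N -> r i < r j.
  move=> /andP[ij jN]; rewrite ltr_rat !g_nth //; last exact: ltn_trans jN.
  by rewrite (lt_sorted_ltn_nth 0 (farey_sorted Q)) ?inE // (ltn_trans ij).
have r_le i j : (i <= j < N)%N -> r i <= r j.
  rewrite leq_eqVlt => /andP[/orP[/eqP -> //|ij] jN].
  by apply/ltW/r_lt; rewrite ij.
have gap_le i : (i < N)%N -> r i.+1 - r i <= Q%:R^-1.
  move=> iN; have [gap _] := farey_adjacent_sqr_gap _ _ _ Q0 (g_adj i iN).
  by move: gap; rewrite -(ler_rat R) rmorphB fmorphV rmorph_nat.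
have sqr_gap_le i : (i < N)%N ->
    Q%:R ^+ 2 * (r i.+1 - r i) ^+ 2 <= u i + u i.+1 + 2 * (r i.+1 - r i).
  move=> iN; have [_ sgap] := farey_adjacent_sqr_gap _ _ _ Q0 (g_adj i iN).
  move: sgap; rewrite /r /u; move: (g i) (g i.+1) => x y.
  rewrite -(ler_rat R).
  by rewrite !(rmorphD, rmorphM, rmorphXn, rmorphN, fmorphV, rmorph_nat).
have [|a [b [/[dup] abN /andP[ab' bN] PE]]] := convex_pred_interval P N.
  move=> i j k /andP[ij jk] kN /andP[ai _] /andP[_ kb]; rewrite /P.
  rewrite (lt_le_trans ai) ?(le_trans _ kb) // r_le ?ij ?jk //.
  exact: leq_ltn_trans kN.
have sumP F : \sum_(0 <= i < N | P i) F i = \sum_(a <= i < b) F i :> R.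
  exact: big_nat_interval.
have S0E : S0 Q `]alpha, beta] = \sum_(a <= i < b) (r i.+1 - r i) ^+ 2.
  have gE i : gamma Q i.+1%:Z = g i by rewrite /g -PoszD addn1.
  rewrite -sumP /S0 big_add1 /=; apply: eq_big => [i|i _].
    by rewrite in_itv gE.
  by rewrite gE rmorphB.
have GE : \sum_(x <- farey_in R Q alpha beta) ((den x)%:R ^+ 2)^-1
    = \sum_(a <= i < b) u i.
  rewrite -sumP /farey_in big_filter (big_nth 0).
  rewrite big_nat_cond [RHS]big_nat_cond; apply: eq_big => [i|i].
    by case: (ltnP i N) => iN; rewrite ?andbF //= /P /r g_nth.
  by move=> /andP[/andP[_ iN] _]; rewrite /u g_nth.
have [ba|ab_lt] := leqP b a.
  rewrite S0E GE !big_geq // !mulr0 add0r.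
  have : 0 <= 2 / Q%:R :> R by rewrite divr_ge0 // ltW.
  lra.
rewrite S0E GE big_distrr /=.
apply: (@le_trans _ _ (\sum_(a <= i < b)
    (2 * u i + (u i.+1 - u i) + 2 * (r i.+1 - r i)))).
  rewrite !big_nat; apply: ler_sum => i /andP[_ ib].
  have := sqr_gap_le i (leq_trans ib bN); lra.
rewrite big_split big_split /= -!big_distrr /= !telescope_sumr //.
case: b ab_lt {ab' abN sumP S0E GE} bN PE => // b ab_lt bN PE.
have : P a by rewrite PE ?leqnn // (leq_ltn_trans _ bN).
have : P b by rewrite PE ?leqnn ?andbT.
have := gap_le b bN; have := u01 a; have := u01 b.+1.
rewrite /P; lra.
Qed.

(** * The bound for C0 *)

Lemma ln_large (R : realType) (Q : nat) : expR (expR 22) <= Q%:R :> R ->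
  [/\ (0 < Q)%N, 23 <= ln Q%:R :> R & (ln Q%:R + 2) / Q%:R <= 2 / 100 :> R].
Proof.
move=> hQ.
have Q0 : 0 < Q%:R :> R by apply: lt_le_trans hQ; exact: expR_gt0.
have L22 : expR 22 <= ln Q%:R :> R by rewrite -ler_expR lnK ?posrE.
have L23 : 23 <= ln Q%:R :> R.
  apply: le_trans L22; apply: le_trans (expR_ge1Dx _); lra.
split=> //; first by rewrite -(ltr0n R).
have L0 : 0 <= ln Q%:R :> R by lra.
have := expR_ge1Dxn 2 L0; rewrite lnK ?posrE // (_ : 3`!%:R = 6 :> R) //.
move: (ln _) L23 L0 => L L23 L0 QL.
rewrite ler_pdivrMr //; nra.
Qed.

Theorem theorem1p4 (R : realType) (Q : nat) (alpha beta : R)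
    (hQ : expR (expR 22) <= Q%:R :> R)
    (hab : alpha < beta)
    (hI : {subset `]alpha, beta] <= `]0, 1]}) :
  C0 Q alpha beta < 12 / pi ^+ 2 + 201 / 100 / ln Q%:R
                    + 706 / 100 / ((beta - alpha) * ln Q%:R)
  /\ (4 / ln Q%:R <= beta - alpha -> C0 Q alpha beta < 3).
Proof.
have [Q0 L23 Lsmall] := ln_large R Q hQ.
have b1 : beta <= 1.
  by have := hI beta; rewrite !in_itv /= hab lexx => /(_ isT)/andP[].
(* Otherwise min(beta, 0) would be a nonpositive point of I. *)
have a0 : 0 <= alpha.
  rewrite leNgt; apply/negP => a_lt0.
  have := hI (Num.min beta 0).
  rewrite !in_itv /= lt_min hab a_lt0 ge_min lexx /=.
  by move=> /(_ isT); rewrite lt_min ltxx andbF.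
have abI : 0 <= alpha < beta by rewrite a0.
have Q0' : 0 < Q%:R :> R by rewrite ltr0n.
have S_le := S0_le R Q alpha beta Q0 hab.
have G_le := sum_inv_den_sqr_le R Q alpha beta Q0 abI b1.
have H_le := harmonic_sum_le R Q Q0.
have k_le : 12 / pi ^+ 2 <= 1200 / 937 :> R.
  have p2 := pi_sqr_ge R.
  have p0 : 0 < pi ^+ 2 :> R by lra.
  rewrite ler_pdivrMr //; lra.
have k_gt0 : 0 < 12 / pi ^+ 2 :> R by rewrite divr_gt0 // exprn_gt0 ?pi_gt0.
have kE : 6 / pi ^+ 2 = 12 / pi ^+ 2 / 2 :> R.
  by rewrite mulrAC; congr (_ / _); lra.
rewrite kE in G_le; rewrite /C0 [S0 _ _ * _]mulrC.
(* From here on only the size of k = 12 / pi^2 matters. *)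
move: (12 / pi ^+ 2) k_le k_gt0 G_le {kE} => k k_le k_gt0 G_le.
set D := beta - alpha in S_le G_le *.
have D_gt0 : 0 < D by rewrite subr_gt0.
have D_le1 : D <= 1 by rewrite /D; lra.
move: (ln _) (_ * S0 _ _) L23 Lsmall H_le S_le => L T L23 Lsmall H_le S_le.
have e0 : 0 < Q%:R^-1 :> R by rewrite invr_gt0.
move: (\sum_(x <- _) _) (harmonic_sum _ _) (Q%:R^-1) e0 G_le H_le S_le Lsmall
  => G H e e0 G_le H_le S_le Lsmall.
have eH : H * e <= (1 + L) * e by rewrite ler_wpM2r // ltW.
have DH : D * H <= D * (1 + L) by rewrite ler_wpM2l // ltW.
have T_le : T <= 3 + 2 * D + k * (D * (L + 3) + 4 * ((L + 1) * e)) + 2 * e.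
  have X_le : D * (H + 2) + 4 * H * e <= D * (L + 3) + 4 * ((L + 1) * e) by lra.
  have := ler_wpM2l (ltW k_gt0) X_le; lra.
have tail_le : k * (4 * ((L + 1) * e)) + 2 * e <= 2 / 10.
  have Le0 : 0 <= (L + 1) * e by rewrite mulr_ge0 ?(ltW e0) //; lra.
  have : k * (4 * ((L + 1) * e)) <= 1200 / 937 * (4 * ((L + 1) * e)).
    by rewrite ler_wpM2r // mulr_ge0.
  nra.
have kD : k * D <= 1200 / 937 * D by rewrite ler_wpM2r // ltW.
have DL0 : 0 < D * L by rewrite mulr_gt0 //; lra.
have {}T_le : T <= 3 + 2 / 10 + 2 * D + k * (D * L)
    + 3 * (1200 / 937 * D) by lra.
split.
  rewrite ltr_pdivrMr //.
  have -> : (k + 201 / 100 / L + 706 / 100 / (D * L)) * (D * L)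
      = k * (D * L) + 201 / 100 * D + 706 / 100.
    by field; rewrite !gt_eqF //; lra.
  lra.
have L0 : 0 < L by lra.
rewrite ler_pdivrMr // => DL4; rewrite ltr_pdivrMr //.
have kDL : k * (D * L) <= 1200 / 937 * (D * L) by rewrite ler_wpM2r // ltW.
have DL23 : 23 * D <= D * L by rewrite mulrC ler_wpM2l // ltW.
lra.
Qed.
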